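(* Let $n\ge 1$, $1\le r\le n$, let $M\subseteq\binom{[n]}{r}$ be the set of bases of a matroid on $[n]$ of rank $r$, and let $v:M\to\mathbb{R}$ be such that $(M,v)$ is a valuated matroid. Let $\Sigma=\Sigma_{M,v}$ be the regular subdivision of $P_M$ induced by $v$, and let $\Gamma$ be the set of boundary faces of $\Sigma$ (cells of $\Sigma$ contained in the boundary of $P_M$) whose corresponding matroid has loops. Then \[ B(M,v)=T_{\Sigma,\Gamma}/\mathbb{R}\mathbf{1}, \] where $T_{\Sigma,\Gamma}$ is the coordinatized extended tight span of $\Sigma$ with respect to $\Gamma$ (equality understood as equality of the union of the cells of $T_{\Sigma,\Gamma}$, modulo $\mathbb{R}\mathbf{1}$, with $B(M,v)$).
   Context: For $B\subseteq[n]$ put $e_B=\sum_{i\in B}e_i\in\mathbb{R}^n$, and for $M\subseteq\binom{[n]}{r}$ let $P_M=\mathrm{conv}\{e_B: B\in M\}$. For $x\in\mathbb{R}^n$ let $M_x=\{B\in M : v(B)-e_B\cdot x \text{ is minimal}\}$. The regular subdivision $\Sigma_{M,v}$ of $P_M$ is the polytopal complex whose cells are the polytopes $P_{M_x}$, $x\in\mathbb{R}^n$ (together with their faces, which are again of this form). $(M,v)$ is a valuated matroid if every cell of $\Sigma_{M,v}$ is the matroid polytope $P_{M'}$ of a matroid $M'$ (i.e. its vertex set $\{B: e_B\in\text{cell}\}$ is the set of bases of a matroid); the matroid corresponding to a cell is this $M'$. A matroid with bases $M'$ on $[n]$ is loop-free if $\bigcup_{B\in M'}B=[n]$. The tropical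 linear space is $B(M,v)=\{x\in\mathbb{R}^n : M_x \text{ is loop-free}\}/\mathbb{R}\mathbf{1}$, where $\mathbf{1}=(1,\dots,1)$. Dual complex: for each cell $\sigma$ of $\Sigma$ the set of $x\in\mathbb{R}^n$ with $P_{M_x}=\sigma$ is a relatively open polyhedron; the topological closures of these sets form a complete polyhedral complex $N_\Sigma$ in $\mathbb{R}^n$, and $\sigma\mapsto$ (its dual cell) is an inclusion-reversing bijection between cells of $\Sigma$ and cells of $N_\Sigma$. Extended tight span: let $\Sigma^{\max}$ be the set of maximal cells of $\Sigma$ and $\Delta_\Sigma$ the set of maximal cells of $\Sigma$ contained in facets of $P_M$; let $S_\Sigma=\Sigma^{\max}\cup\Delta_\Sigma$. Define $\mathrm{cl}^\Sigma(\emptyset)=\emptyset$ and, for nonempty $F\subseteq S_\Sigma$, $\mathrm{cl}^\Sigma(F)=\{g\in S_\Sigma : \bigcap_{\sigma\in F}\sigma\subseteq g\}$. For a collection $\Gamma$ of boundary cells of $\Sigma$, let $\Lambda_\Gamma$ be the set of $\mathrm{cl}^\Sigma$-closed sets $F$ with $\bigcap_{\sigma\in F}\sigma\not\subseteq\tau$ for all $\tau\in\Gamma$, and let $\mathrm{cl}^\Sigma_\Gamma(F)=\mathrm{cl}^\Sigma(F)$ if $\mathrm{cl}^\Sigma(F)\in\Lambda_\Gamma$ and $\mathrm{cl}^\Sigma_\Gamma(F)=S_\Sigma$ otherwise. For a nonempty closed set $F\subsetneq S_\Sigma$ of $\mathrm{cl}^\Sigma_\Gamma$, the intersection $\bigcap_{\sigma\in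 F}\sigma$ is a cell of $\Sigma$; let $\rho_F$ denote its dual cell in $N_\Sigma$ (and $\rho_\emptyset=\emptyset$). Then $T_{\Sigma,\Gamma}=\{\rho_F : F\subsetneq S_\Sigma \text{ closed w.r.t. } \mathrm{cl}^\Sigma_\Gamma\}$, a subcomplex of $N_\Sigma$.
   Formalization: With the relative boundary of P_M the claim is proved only for loop-free M (it fails for M with loops, e.g. M={{1},{2}} on [3], v=0); for arbitrary M it is proved with the topological boundary in R^n, so every cell with loops is in Γ. A point has the empty face as its facet. *)

(* Defs.v *)
From HB Require Import structures.
From mathcomp Require Import all_boot all_order all_algebra.
From mathcomp Require Import all_classical all_reals all_analysis.

Set Implicit Arguments.
Unset Strict Implicit.
Unset Printing Implicit Defensive.

Import Order.TTheory GRing.Theory Num.Theory.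
Import numFieldNormedType.Exports.

Local Open Scope classical_set_scope.
Local Open Scope ring_scope.

(* Subsets of [n] and families of such are finite sets ({set _}, scope %SET);
   subsets of R^n = 'rV[R]_n and families of such are classical sets (set _).
   The ground set [n] = {1, ..., n} is 'I_n. *)

Section Matroids.
Variable n : nat.

Definition is_matroid (M : {set {set 'I_n}}) : Prop :=
  (exists B, B \in M) /\
  (forall A B : {set 'I_n}, A \in M -> B \in M ->
   forall a, a \in (A :\: B)%SET ->
   exists2 b, b \in (B :\: A)%SET & (b |: (A :\ a))%SET \in M).

Definition has_rank (r : nat) (M : {set {set 'I_n}}) : Prop :=
  forall B, B \in M -> #|B| = r.

Definition loop_free (M : {set {set 'I_n}}) : Prop :=
  (\bigcup_(B in M) B)%SET = [set: 'I_n]%SET.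

End Matroids.

Section Polytopes.
Variables (R : realType) (n : nat).
Implicit Types (x y : 'rV[R]_n) (P F : set 'rV[R]_n) (M : {set {set 'I_n}}).

Definition dotv x y : R := \sum_(i < n) x 0 i * y 0 i.

Definition incidence_vector (B : {set 'I_n}) : 'rV[R]_n := \row_i (i \in B)%:R.

Definition matroid_polytope M : set 'rV[R]_n :=
  [set p | exists w : {set 'I_n} -> R,
     [/\ forall B, B \in M -> 0 <= w B,
         \sum_(B in M) w B = 1
       & p = \sum_(B in M) w B *: incidence_vector B]].

(* The empty set and (taking c = 0) P itself are faces of P. *)
Definition is_face P F : Prop :=
  F = set0 \/
  exists c : 'rV[R]_n, F = [set p | P p /\ forall q, P q -> dotv c q <= dotv c p].

Definition is_proper_face P F : Prop := is_face P F /\ F <> P.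

(* Faces of codimension one.  In particular the empty face, of dimension -1,
   is the unique facet of a point. *)
Definition is_facet P F : Prop :=
  is_proper_face P F /\
  forall G, is_proper_face P G -> F `<=` G -> G = F.

Definition relative_boundary P : set 'rV[R]_n :=
  \bigcup_(F in is_proper_face P) F.

Definition topological_boundary P : set 'rV[R]_n := closure P `\` interior P.

End Polytopes.

Arguments incidence_vector R {n} B.
Arguments matroid_polytope R {n} M _.

Section RegularSubdivision.
Variables (R : realType) (n : nat).
Variables (M : {set {set 'I_n}}) (v : {set 'I_n} -> R).
Implicit Types (x : 'rV[R]_n) (s t : set 'rV[R]_n).

Definition selected x : {set {set 'I_n}} :=
  [set B in M | [forall (C | C \in M),
     v B - dotv (incidence_vector R B) x <= v C - dotv (incidence_vector R C) x]]%SET.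

(* As in any polytopal complex, the empty face is a cell. *)
Definition is_cell s : Prop :=
  exists x, is_face (matroid_polytope R (selected x)) s.

Definition cell_bases s : {set {set 'I_n}} :=
  [set B : {set 'I_n} | `[< s (incidence_vector R B) >]]%SET.

Definition is_valuated_matroid : Prop :=
  forall s, is_cell s -> s !=set0 ->
    is_matroid (cell_bases s) /\ s = matroid_polytope R (cell_bases s).

Definition dual_cell s : set 'rV[R]_n :=
  closure [set x | matroid_polytope R (selected x) = s].

Definition in_facet s : Prop :=
  exists2 F, is_facet (matroid_polytope R M) F & s `<=` F.

Definition max_cells : set (set 'rV[R]_n) :=
  [set s | is_cell s /\ forall t, is_cell t -> s `<=` t -> t = s].

Definition max_facet_cells : set (set 'rV[R]_n) :=
  [set s | [/\ is_cell s, in_facet s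
    & forall t, is_cell t -> in_facet t -> s `<=` t -> t = s]].

Definition ground : set (set 'rV[R]_n) := max_cells `|` max_facet_cells.

Definition cl (F : set (set 'rV[R]_n)) : set (set 'rV[R]_n) :=
  [set g | [/\ F !=set0, ground g & \bigcap_(s in F) s `<=` g]].

Variable Gamma : set (set 'rV[R]_n).

Definition Lambda : set (set (set 'rV[R]_n)) :=
  [set F | [/\ F `<=` ground, cl F = F
    & forall t, Gamma t -> ~ (\bigcap_(s in F) s `<=` t)]].

Definition cl_Gamma (F : set (set 'rV[R]_n)) : set (set 'rV[R]_n) :=
  if `[< Lambda (cl F) >] then cl F else ground.

Definition rho (F : set (set 'rV[R]_n)) : set 'rV[R]_n :=
  if `[< F = set0 >] then set0 else dual_cell (\bigcap_(s in F) s).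

Definition extended_tight_span : set (set 'rV[R]_n) :=
  [set rho F | F in [set F | F `<` ground /\ cl_Gamma F = F]].

End RegularSubdivision.

Section TropicalLinearSpace.
Variables (R : realType) (n : nat).

(* X / R1, as the set of cosets x + R1 with x in X. *)
Definition mod_ones (X : set 'rV[R]_n) : set (set 'rV[R]_n) :=
  [set [set y | exists c : R, y = x + const_mx c] | x in X].

Definition tropical_linear_space (M : {set {set 'I_n}}) (v : {set 'I_n} -> R) :
    set (set 'rV[R]_n) :=
  mod_ones [set x | loop_free (selected M v x)].

(* The matroid of a cell is only defined for nonempty cells. *)
Definition loopy_cells_in (bd : set 'rV[R]_n)
    (M : {set {set 'I_n}}) (v : {set 'I_n} -> R) : set (set 'rV[R]_n) :=
  [set s | [/\ is_cell M v s, s !=set0, s `<=` bd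
    & ~ loop_free (cell_bases s)]].

(* The polytope P_M lies in the hyperplane x_1 + ... + x_n = r, so its
   topological boundary in R^n is all of P_M.  Boundary faces with loops are
   the same for both boundaries when M is loop-free.  When M has loops, P_M
   itself is a face with loops that belongs to the topological boundary but
   not to the relative one. *)
Definition boundary_loopy_cells (M : {set {set 'I_n}}) v : set (set 'rV[R]_n) :=
  loopy_cells_in (topological_boundary (matroid_polytope R M)) M v.

Definition relative_boundary_loopy_cells (M : {set {set 'I_n}}) v : set (set 'rV[R]_n) :=
  loopy_cells_in (relative_boundary (matroid_polytope R M)) M v.

Definition union_of_cells (T : set (set 'rV[R]_n)) : set 'rV[R]_n :=
  \bigcup_(s in T) s.

End TropicalLinearSpace.

(* Main.v *)
(* Every nonempty cell is P_(M_x) for some x, so everything reduces to the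
   finite sets M_x.  A cell is the intersection of the maximal cells and maximal
   facet cells above it: if B is not in M_z, take a largest M_x above M_z
   avoiding B; if it is not a maximal cell, then moving x along a line on which
   M_x stays selected yields a face of P_M above M_z avoiding B, this face lies
   in a facet avoiding B, and a maximal cell of the facet does the job.  Hence
   the cells P_(M_z) with M_z loop-free are exactly those indexing the extended
   tight span, and passing to the closure of a dual cell only enlarges M_x,
   which preserves loop-freeness. *)
Require Import Defs.
From mathcomp Require Import all_boot all_order all_algebra.
From mathcomp Require Import all_classical all_reals all_analysis.
From mathcomp Require Import ring lra.

Local Open Scope ring_scope.

Import Order.TTheory GRing.Theory Num.Theory.
Import numFieldNormedType.Exports.

(** * Minimisers of functions on a finite set *)

Section Argmin.
Set Implicit Arguments.
Unset Strict Implicit.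
Context {R : realFieldType} {T : finType}.
Implicit Types (A : {set T}) (f g : T -> R) (B C D : T).

Definition argmin A f : {set T} :=
  [set B in A | [forall (C | C \in A), f B <= f C]]%SET.

Lemma argminP A f B :
  reflect (B \in A /\ forall C, C \in A -> f B <= f C) (B \in argmin A f).
Proof.
rewrite inE; apply: (iffP andP) => -[BA].
  by move/forall_inP.
by move=> h; split => //; apply/forall_inP.
Qed.

Lemma argmin_sub A f : argmin A f \subset A.
Proof. by apply/fintype.subsetP => B /argminP[]. Qed.

Lemma argmin_ex A f B : B \in A -> exists C, C \in argmin A f.
Proof.
move=> BA; case: (@arg_minP _ _ _ B (mem A) f BA) => C CA h.
by exists C; apply/argminP.
Qed.

Lemma eq_argmin A f g : {in A &, forall B C, (f B <= f C) = (g B <= g C)} ->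
  argmin A f = argmin A g.
Proof.
move=> h; apply/setP => B; apply/argminP/argminP => -[BA hB];
  by split => // C CA; move: (hB C CA); rewrite h.
Qed.

Lemma argmin_le A f B C : C \in argmin A f -> B \in A -> f B <= f C ->
  B \in argmin A f.
Proof.
move=> /argminP[CA hC] BA BC; apply/argminP; split => // D DA.
exact: le_trans BC (hC _ DA).
Qed.

Lemma argmin_eq A f B C : B \in argmin A f -> C \in argmin A f -> f B = f C.
Proof.
move=> /argminP[BA hB] /argminP[CA hC].
by apply/eqP; rewrite eq_le hB// hC.
Qed.

Lemma argmin_subset A A' f B : A' \subset A -> B \in argmin A f -> B \in A' ->
  argmin A' f = argmin A f :&: A'.
Proof.
move=> /fintype.subsetP sA BA BA'; apply/setP => C; rewrite finset.in_setI.
apply/argminP/andP => [[CA' hC]|[/argminP[_ hC] CA']]; split => //.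
  by apply: (argmin_le BA); [exact: sA|exact: hC].
by move=> D DA'; apply/hC/sA.
Qed.

(** A lexicographic minimisation, first [f] and then [g], becomes a single one once [f] has a large
    enough weight. This turns iterated faces into selections at one point. *)
Lemma argmin_lex A f g :
  exists2 t, 0 < t & argmin A (fun C => t * f C + g C) = argmin (argmin A f) g.
Proof.
have [->|/set0Pn[A0 A0A]] := eqVneq A finset.set0.
  by exists 1 => //; apply/setP => B; rewrite !inE.
have [F0 F0A] := argmin_ex f A0A.
have [B0 B0A] := argmin_ex g F0A.
have B0F : B0 \in argmin A f by apply: (fintype.subsetP (argmin_sub _ _)) B0A.
have [B0M B0f] := argminP _ _ _ B0F.
have [_ B0g] := argminP _ _ _ B0A.
(* [t] exceeds each quotient separately, so any loss in [f] outweighs the possible gain in [g].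
   Terms with [f C = f B0] are divisions by zero, hence [0]. *)
pose t := 1 + \sum_C `|(g B0 - g C) / (f C - f B0)|.
have t0 : 0 < t by rewrite ltr_pwDl// sumr_ge0.
have tC C : C \in A -> f B0 < f C -> t * f B0 + g B0 < t * f C + g C.
  move=> CA fC; have fC0 : 0 < f C - f B0 by rewrite subr_gt0.
  suff : g B0 - g C < t * (f C - f B0) by lra.
  rewrite -ltr_pdivrMr//; apply: (le_lt_trans (ler_norm _)).
  rewrite /t (bigD1 C)//= addrCA ltrDl ltr_pwDl// sumr_ge0//.
exists t => //; apply/setP => B.
apply/idP/idP => [/argminP[BA hB]|/argminP[BF hB]]; apply/argminP.
  have BF : f B <= f B0.
    by rewrite leNgt; apply/negP => /(tC _ BA); rewrite ltNge hB.
  have BF' := argmin_le B0F BA BF.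
  split=> // C CF; have := hB C (fintype.subsetP (argmin_sub _ _) _ CF).
  by rewrite (argmin_eq BF' CF) lerD2l.
have BA := fintype.subsetP (argmin_sub _ _) _ BF.
split=> // C CA; have [fC|fC] := ltP (f B0) (f C).
  apply: le_trans (ltW (tC C CA fC)).
  by rewrite (argmin_eq BF B0F) lerD2l hB.
have CF := argmin_le B0F CA fC.
by rewrite (argmin_eq BF CF) lerD2l hB.
Qed.

(* Ratio test: subtract the largest multiple of [g] keeping [C0] minimal. *)
Lemma argmin_ratio_test A f g C0 D : C0 \in argmin A f ->
  {in argmin A f, forall C, g C = g C0} -> D \in A -> g C0 < g D ->
  exists t, let A' := argmin A (fun C => f C - t * g C) in
    [/\ argmin A f \subset A',
        exists2 C, C \in A' & g C0 < g C
      & forall B, B \in A' -> g B <= g C0 -> B \in argmin A f].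
Proof.
move=> C0f gC0 DA gD.
have [C0A C0m] := argminP _ _ _ C0f.
pose P := [pred C | (C \in A) && (g C0 < g C)].
have PD : P D by rewrite /= DA.
(* [E] has the smallest ratio, so it is among the first elements of larger [g] to tie with [C0] as
   the multiple of [g] grows. *)
case: (@arg_minP _ _ _ D P (fun C => (f C - f C0) / (g C - g C0)) PD) => E.
move=> /andP[EA gE] hE.
set t := (f E - f C0) / (g E - g C0) in hE.
have gE0 : 0 < g E - g C0 by rewrite subr_gt0.
have fEt : f E - f C0 = t * (g E - g C0) by rewrite /t divfK// gt_eqF.
have t0 : 0 < t.
  rewrite divr_gt0// subr_gt0 lt_neqAle C0m// andbT; apply/eqP => fE.
  have /gC0 gEE : E \in argmin A f by apply: (argmin_le C0f EA); rewrite fE.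
  by rewrite gEE ltxx in gE.
have key C : C \in A -> f C0 - t * g C0 <= f C - t * g C.
  move=> CA; have [gC|gC] := leP (g C) (g C0).
    have := ler_wpM2l (ltW t0) gC; have := C0m C CA; lra.
  have : t <= (f C - f C0) / (g C - g C0) by apply: hE; rewrite /= CA.
  rewrite ler_pdivlMr ?subr_gt0//; lra.
have C0' : C0 \in argmin A (fun C => f C - t * g C) by apply/argminP.
exists t; split.
- apply/fintype.subsetP => C Cf; apply: (argmin_le C0').
    by apply: (fintype.subsetP (argmin_sub _ _)) Cf.
  by rewrite (argmin_eq Cf C0f) gC0.
- exists E => //; apply: (argmin_le C0') => //; lra.
- move=> B BA' gB; have [BA _] := argminP _ _ _ BA'.
  apply: (argmin_le C0f BA).
  have := ler_wpM2l (ltW t0) gB; have /= := argmin_eq BA' C0'; lra.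
Qed.

Lemma max_ex (P : {set T} -> Prop) A : P A ->
  exists A', [/\ P A', A \subset A' & forall A'', P A'' -> A' \subset A'' -> A'' = A'].
Proof.
move=> PA; have PA' : `[<P A>] by exact/asboolP.
have [A' /maxsetP[/asboolP PA'' h] AA'] :=
  @maxset_exists T (fun B : {set T} => `[<P B>]) A PA'.
by exists A'; split => // A'' ? ?; apply: h => //; exact/asboolP.
Qed.

End Argmin.

(** * Cells and faces as selections from a finite point configuration *)

Section Selection.
Set Implicit Arguments.
Unset Strict Implicit.
Context {R : realFieldType} {T : finType} {V : lmodType R}.
Variables (l : T -> V -> R) (M : {set T}) (v : T -> R).
(* [l C x] stands for the scalar product of x with the vertex C: [sel x] is the
   set M_x and [top d] the face of the point configuration in direction d. *)
Hypothesis lDZ : forall C x t e, l C (x + t *: e) = l C x + t * l C e.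
Implicit Types (x y d e : V) (B C D : T).

Let sel x := argmin M (fun C => v C - l C x).
Let top d := argmin M (fun C => - l C d).

Let lN C x : l C (- x) = - l C x.
Proof.
have := lDZ C 0 1 0; rewrite scaler0 addr0 => l0.
by have := lDZ C 0 (-1) x; rewrite scaleN1r add0r => ->; lra.
Qed.

Let lB C x y : l C (x - y) = l C x - l C y.
Proof. by rewrite -scaleN1r lDZ mulN1r. Qed.

(** Moving [x] slightly in direction [d] breaks the ties in [sel x] by [d]: with [f] of weight [t]
    in [argmin_lex], dividing by [t] gives the point [x + t^-1 *: d]. *)
Lemma sel_face x d : exists y, sel y = argmin (sel x) (fun C => - l C d).
Proof.
have [t t0 <-] := argmin_lex M (fun C => v C - l C x) (fun C => - l C d).
exists (x + t^-1 *: d); apply: eq_argmin => B C BM CM.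
rewrite -(ler_pM2l t0) !lDZ.
have E a b c : t * (a - (b + t^-1 * c)) = t * (a - b) - c.
  by field; rewrite gt_eqF.
by rewrite !E.
Qed.

(** Opposite order of priorities: going far from [x] in direction [d] restricts the subdivision to
    the face [top d]. *)
Lemma top_sel x d : exists y, sel y = argmin (top d) (fun C => v C - l C x).
Proof.
have [t t0 <-] := argmin_lex M (fun C => - l C d) (fun C => v C - l C x).
exists (x + t *: d); apply: eq_argmin => B C BM CM.
rewrite !lDZ.
by congr (_ <= _); ring.
Qed.

Lemma sel_shift A x e t :
  argmin A (fun C => v C - l C x - t * l C e) =
  argmin A (fun C => v C - l C (x + t *: e)).
Proof.
apply: eq_argmin => B C _ _.
by rewrite !lDZ !opprD !addrA.
Qed.

Lemma max_sel_or_top z B : M != finset.set0 -> B \in M -> B \notin sel z ->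
  (exists x, [/\ sel z \subset sel x, B \notin sel x
     & forall y, sel x \subset sel y -> sel y = sel x])
  \/ exists d, sel z \subset top d /\ B \notin top d.
Proof.
move=> /set0Pn[A0 A0M] BM Bz.
have [C0 C0z] := argmin_ex (fun C => v C - l C z) A0M.
have [_ [[x [-> Bx]] zx hx]] := @max_ex T
  (fun A : {set T} => exists x, A = sel x /\ B \notin sel x) (sel z)
  (ex_intro _ z (conj erefl Bz)).
have C0x : C0 \in sel x by apply: (fintype.subsetP zx) C0z.
(* [x] is maximal only among selections avoiding [B]. Either it is maximal among all, or some [y]
   selects strictly more. *)
have [|] := pselect (forall y, sel x \subset sel y -> sel y = sel x).
  by left; exists x.
move=> /existsNP[y /not_implyP[xy yx]]; right.
have C0y : C0 \in sel y by apply: (fintype.subsetP xy).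
(* If some [D] exceeded [C0] along [e], the ratio test would enlarge [sel x] strictly while still
   avoiding [B], against the choice of [x]. *)
have claim e : {in sel x, forall C, l C e = l C0 e} -> l B e <= l C0 e ->
    {in M, forall D, l D e <= l C0 e}.
  move=> ex eB D DM; rewrite leNgt; apply/negP => eD.
  have [t] := argmin_ratio_test C0x ex DM eD.
  rewrite /= (sel_shift M x e t) => -[s1 [E E1 E2] s3].
  have BN : B \notin sel (x + t *: e).
    by apply/negP => /s3/(_ eB) h; rewrite h in Bx.
  have := hx _ (ex_intro _ _ (conj erefl BN)) s1.
  by move=> ExE; move: E1 E2; rewrite -/(sel _) ExE => /ex ->; rewrite ltxx.
(* All of [sel x] is selected at both ends, so this direction is constant on it. *)
pose e := y - x.
have econst : {in sel x, forall C, l C e = l C0 e}.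
  move=> C Cx; rewrite /e !lB.
  have := argmin_eq Cx C0x; have := argmin_eq (fintype.subsetP xy _ Cx) C0y.
  by rewrite /=; lra.
have Neconst : {in sel x, forall C, l C (- e) = l C0 (- e)}.
  by move=> C Cx; rewrite !lN econst.
(* By [claim], [d] attains its maximum over [M] on [sel x] and not at [B], so [top d] is the
   required face. *)
have aux d : {in sel x, forall C, l C d = l C0 d} -> l B d < l C0 d ->
    exists d, sel z \subset top d /\ B \notin top d.
  move=> dx dB; have h := claim d dx (ltW dB); exists d; split.
    apply/fintype.subsetP => C Cz.
    have Cx := fintype.subsetP zx _ Cz.
    apply/argminP; split; first by apply: (fintype.subsetP (argmin_sub _ _)) Cx.
    by move=> D DM; rewrite lerN2 (dx C)// h.
  apply/negP => /argminP[_ /(_ C0)]; rewrite lerN2 leNgt dB => h'.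
  by apply: notF; apply: h'; apply: (fintype.subsetP (argmin_sub _ _)) C0z.
have [eB|eB|eB] := ltgtP (l B e) (l C0 e); first exact: aux eB.
  by apply: (aux (- e)) => //; rewrite !lN ltrN2.
(* If [e] does not distinguish [B] from [C0], then [claim] for [e] and [- e] makes [e] constant on
   [M]; hence [x] and [y] select the same set. *)
exfalso; apply: yx; apply/setP => D; apply/idP/idP; last exact: (fintype.subsetP xy).
move=> Dy; have DM := fintype.subsetP (argmin_sub _ _) _ Dy.
have h1 : l D e <= l C0 e by apply: claim => //; rewrite eB.
have h2 : l D (- e) <= l C0 (- e) by apply: claim => //; rewrite !lN eB.
apply: (argmin_le C0x DM).
have /= := argmin_eq Dy C0y; move: h1 h2; rewrite /e !(lN, lB); lra.
Qed.

(* Rotating about a face avoiding [B] within the pencil it spans with a larger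
   face containing [B] gives a larger face still avoiding [B]. *)
Lemma top_max d B (A : {set T}) : A \subset top d -> A != finset.set0 -> B \in M -> B \notin top d ->
  exists d', [/\ A \subset top d', B \notin top d'
    & forall d'', top d' \subset top d'' -> top d'' != M -> top d'' = top d'].
Proof.
move=> Ad /set0Pn[C0 C0A] BM Bd.
have [_ [[d1 [-> B1]] s1 h1]] := @max_ex T
  (fun A : {set T} => exists x, A = top x /\ B \notin top x) (top d)
  (ex_intro _ d (conj erefl Bd)).
have C01 : C0 \in top d1 by apply/(fintype.subsetP s1)/(fintype.subsetP Ad).
exists d1; split => //; first exact: fintype.subset_trans s1.
move=> d2 s2 N2; have C02 := fintype.subsetP s2 _ C01.
have [B2|B2] := boolP (B \in top d2); last by apply: h1 => //; exists d2.
exfalso.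
have /fintype.subsetPn[D DM D2] : ~~ (M \subset top d2).
  by apply: contra N2 => h; rewrite finset.eqEsubset h argmin_sub.
have gD : - l C0 d2 < - l D d2.
  by rewrite ltNge; apply/negP => h; rewrite (argmin_le C02 DM h) in D2.
have [t] := @argmin_ratio_test _ _ M (fun C => - l C d1) (fun C => - l C d2) C0 D C01
  (fun C CA => argmin_eq (fintype.subsetP s2 _ CA) C02) DM gD.
have -> : argmin M (fun C => - l C d1 - t * - l C d2) = top (d1 + (- t) *: d2).
  by apply: eq_argmin => E F _ _; rewrite !lDZ; congr (_ <= _); ring.
move=> [s3 [E E3 E4] h3].
have BN : B \notin top (d1 + (- t) *: d2).
  apply/negP => /h3 h; move: B1; rewrite h//.
  by rewrite (argmin_eq B2 C02).
have E0 := h1 _ (ex_intro _ _ (conj erefl BN)) s3.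
rewrite E0 in E3.
by move: E4; rewrite (argmin_eq (fintype.subsetP s2 _ E3) C02) ltxx.
Qed.

(* A maximal cell of a facet spans the facet affinely, so it is not contained in
   a cell of another facet. *)
Lemma sel_top_max z d : M != finset.set0 -> sel z \subset top d -> top d != M ->
  (forall d', top d \subset top d' -> top d' != M -> top d' = top d) ->
  exists y, [/\ sel z \subset sel y, sel y \subset top d
    & forall y' d', sel y \subset sel y' -> sel y' \subset top d' -> top d' != M ->
        sel y' = sel y].
Proof.
move=> /set0Pn[A0 A0M] zd dM dmax.
have [C0 C0z] := argmin_ex (fun C => v C - l C z) A0M.
have [_ [[y [-> yd]] zy hy]] := @max_ex T
  (fun A : {set T} => exists x, A = sel x /\ sel x \subset top d) (sel z)
  (ex_intro _ z (conj erefl zd)).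
have C0y : C0 \in sel y by apply: (fintype.subsetP zy).
have C0d : C0 \in top d by apply: (fintype.subsetP yd).
(* Seen inside the face [top d], the ratio test can only enlarge [sel y] within that face. *)
have Ey : argmin (top d) (fun C => v C - l C y) = sel y.
  by rewrite (argmin_subset (argmin_sub _ _) C0y C0d); apply/finset.setIidPl.
have claim e : {in sel y, forall C, l C e = l C0 e} ->
    {in top d, forall D, l D e <= l C0 e}.
  move=> ey D Dd; rewrite leNgt; apply/negP => eD.
  have C0y' := C0y; have ey' := ey; rewrite -Ey in C0y' ey'.
  have [t] := argmin_ratio_test C0y' ey' Dd eD.
  rewrite /= sel_shift Ey; have [y' y'E] := top_sel (y + t *: e) d.
  have y'd : sel y' \subset top d by rewrite y'E argmin_sub.
  rewrite -y'E => -[s1 [E E1 E2] _].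
  have Ey' := hy _ (ex_intro _ y' (conj erefl y'd)) s1.
  by move: E1 E2; rewrite Ey' => /ey ->; rewrite ltxx.
exists y; split => // y' d' yy' yd' d'M.
have C0d' : C0 \in top d' by apply/(fintype.subsetP yd')/(fintype.subsetP yy').
have d'y : {in sel y, forall C, l C d' = l C0 d'}.
  move=> C Cy.
  have /argmin_eq/(_ C0d') : C \in top d' by apply/(fintype.subsetP yd')/(fintype.subsetP yy').
  by move/oppr_inj.
(* [d'] is maximal over [M] at [C0], and [claim] for [- d'] shows that it is minimal over [top d]
   there. So it is constant on [top d], and maximality of the facet gives equality. *)
have dd' : top d \subset top d'.
  apply/fintype.subsetP => C Cd; apply: (argmin_le C0d').
    by apply: (fintype.subsetP (argmin_sub _ _)) Cd.
  rewrite lerN2 -lerN2 -!lN; apply: (claim (- d')) Cd => E Ey'.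
  by rewrite !lN d'y.
have E := dmax _ dd' d'M; rewrite E in yd'.
by apply: hy => //; exists y'.
Qed.

End Selection.

(** * Polytopes spanned by 0/1 vectors: points, vertices and faces *)

Section Polytope.
Set Implicit Arguments.
Unset Strict Implicit.
Local Open Scope classical_set_scope.
Variables (R : realType) (n : nat).
Implicit Types (x y c p q : 'rV[R]_n) (A B C : {set 'I_n}) (M N : {set {set 'I_n}}).
Local Notation e := (incidence_vector R).
Local Notation P := (matroid_polytope R).
Local Notation top N c := (argmin N (fun C => - dotv (e C) c)).

Lemma dotvC x y : dotv x y = dotv y x.
Proof. by apply: eq_bigr => i _; rewrite mulrC. Qed.

Lemma dotvDZ x y (t : R) z : dotv x (y + t *: z) = dotv x y + t * dotv x z.
Proof.
rewrite /dotv mulr_sumr -big_split/=; apply: eq_bigr => i _.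
by rewrite !mxE; ring.
Qed.

Lemma dotv0 x : dotv x 0 = 0.
Proof. by rewrite /dotv big1// => i _; rewrite mxE mulr0. Qed.

Lemma dotv_sum N (w : {set 'I_n} -> R) c :
  dotv c (\sum_(B in N) w B *: e B) = \sum_(B in N) w B * dotv (e B) c.
Proof.
transitivity (\sum_(B in N) dotv c (w B *: e B)).
  rewrite /dotv exchange_big/=; apply: eq_bigr => i _.
  by rewrite summxE mulr_sumr.
apply: eq_bigr => B _; rewrite -[w B *: e B]add0r dotvDZ dotv0 add0r.
by rewrite dotvC.
Qed.

Lemma dotv_continuous (a : 'rV[R]_n) : continuous (dotv a).
Proof.
have h i : continuous (fun x : 'rV[R]_n => a 0 i * x 0 i).
  by move=> x; exact: (cvgM (cvg_cst (a 0 i)) (@coord_continuous R 1 n 0 i x)).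
have ac : continuous (fun z : R * R => z.1 + z.2) by move=> z; exact: add_continuous.
exact (@continuous_big R 'I_n +%R 0 xpredT ac 'rV[R]_n _
  (fun i x => a 0 i * x 0 i) (fun i _ => h i)).
Qed.

(** Only the support of the weights matters: they are extended by zero outside [N]. *)
Lemma polytope_restrict N N' (w : {set 'I_n} -> R) :
  (forall B, B \in N -> 0 <= w B) -> \sum_(B in N) w B = 1 ->
  (forall B, B \in N -> w B != 0 -> B \in N') ->
  P N' (\sum_(B in N) w B *: e B).
Proof.
move=> w0 w1 NN'; exists (fun B => if B \in N then w B else 0); split.
- by move=> B _; case: ifPn => // /w0.
- rewrite -w1 big_mkcond [RHS]big_mkcond/=; apply: eq_bigr => B _.
  have [BN|BN] := boolP (B \in N); last by rewrite if_same.
  have [//|BN'] := boolP (B \in N'); have [<-//|wB] := eqVneq (w B) 0.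
  by rewrite NN' in BN'.
- rewrite big_mkcond [RHS]big_mkcond/=; apply: eq_bigr => B _.
  have [BN|BN] := boolP (B \in N); last by rewrite scale0r if_same.
  have [//|BN'] := boolP (B \in N'); have [->|wB] := eqVneq (w B) 0; first by rewrite scale0r.
  by rewrite NN' in BN'.
Qed.

Lemma polytope_subset N N' : N \subset N' -> P N `<=` P N'.
Proof.
move=> /fintype.subsetP NN' _ [w [w0 w1 ->]].
by apply: polytope_restrict => // B /NN'.
Qed.

(** Coordinates of [e B] are the extreme values 0 and 1, so every vector of nonzero weight in a
    convex combination equal to [e B] agrees with it in each coordinate. *)
Lemma polytope_vertex N B : P N (e B) <-> B \in N.
Proof.
split=> [[w [w0 w1 eB]]|BN]; last first.
  exists (fun C => (C == B)%:R); split => //.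
    by rewrite (bigD1 B)//= eqxx big1 ?addr0// => C /andP[_ /negbTE ->].
  rewrite (bigD1 B)//= eqxx scale1r big1 ?addr0// => C /andP[_ /negbTE ->].
  by rewrite scale0r.
have [C CN wC] : exists2 C, C \in N & w C != 0.
  apply: contrapT => h; move: (oner_neq0 R); rewrite -w1 big1 ?eqxx// => C CN.
  by apply/eqP; apply/negPn/negP => wC; apply: h; exists C.
suff <- : C = B by [].
have eBi i : (i \in B)%:R = \sum_(D in N) w D * (i \in D)%:R.
  have := congr1 (fun x : 'rV[R]_n => x ord0 i) eB; rewrite mxE summxE => ->.
  by apply: eq_bigr => D _; rewrite !mxE.
apply/setP => i; have := eBi i; have [iB|iB] := boolP (i \in B).
  move=> h; apply/negPn/negP => iC; move/eqP: wC; apply.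
  have : \sum_(D in N) w D * (1 - (i \in D)%:R) = 0.
    under eq_bigr do rewrite mulrBr mulr1.
    by rewrite sumrB w1 -h subrr.
  move/psumr_eq0P => /(_ _ C CN); rewrite (negbTE iC) subr0 mulr1; apply.
  by move=> D DN; rewrite mulr_ge0 ?w0// subr_ge0 lern1 leq_b1.
move/esym => /psumr_eq0P => /(_ _ C CN) h; apply/negbTE/negP => iC.
move/eqP: wC; apply; rewrite iC mulr1 in h; apply: h.
by move=> D DN; rewrite mulr_ge0 ?w0.
Qed.

Lemma polytope_subE N N' : P N `<=` P N' <-> N \subset N'.
Proof.
split; last exact: polytope_subset.
by move=> h; apply/fintype.subsetP => B /polytope_vertex/h/polytope_vertex.
Qed.

Lemma polytope_inj : injective (fun N => P N).
Proof.
move=> N N' E; apply/eqP; rewrite finset.eqEsubset.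
by apply/andP; split; apply/polytope_subE; rewrite E.
Qed.

Lemma cell_bases_polytope N : cell_bases (P N) = N.
Proof. by apply/setP => B; rewrite inE; apply/asboolP/idP => /polytope_vertex. Qed.

(** The weighted mean of the nonnegative gaps [f B - m] vanishes, so each gap of nonzero weight
    does. *)
Lemma weights_argmin N (w f : {set 'I_n} -> R) (m : R) :
  (forall B, B \in N -> 0 <= w B) -> \sum_(B in N) w B = 1 ->
  (forall B, B \in N -> m <= f B) -> \sum_(B in N) w B * f B <= m ->
  forall B, B \in N -> w B != 0 -> f B = m.
Proof.
move=> w0 w1 fm wf.
have g0 B : B \in N -> 0 <= w B * (f B - m).
  by move=> BN; rewrite mulr_ge0 ?w0// subr_ge0 fm.
have : \sum_(B in N) w B * (f B - m) = 0.
  apply/le_anti/andP; split; last exact: sumr_ge0.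
  under eq_bigr do rewrite mulrBr.
  by rewrite sumrB -mulr_suml w1 mul1r subr_le0.
move/(psumr_eq0P g0) => h B BN wB; have /eqP := h B BN.
by rewrite mulf_eq0 (negbTE wB)/= subr_eq0 => /eqP.
Qed.

(** A linear form on a hull is maximal exactly at the combinations of generators maximising it. This
    reduces faces to the finite sets [top N c]. *)
Lemma polytope_face N c : N != finset.set0 ->
  [set p | P N p /\ forall q, P N q -> dotv c q <= dotv c p] = P (top N c).
Proof.
move=> /set0Pn[B0 B0N].
have [B1 B1t] := argmin_ex (fun C => - dotv (e C) c) B0N.
have [B1N B1m] := argminP _ _ _ B1t.
apply/seteqP; split => [_ [[w [w0 w1 ->]]] h|_ [w [w0 w1 ->]]].
  apply: polytope_restrict => // B BN wB; apply: (argmin_le B1t BN).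
  have := @weights_argmin N w (fun C => - dotv (e C) c) (- dotv (e B1) c) w0 w1 B1m.
  have := h _ (proj2 (polytope_vertex N B1) B1N); rewrite dotv_sum dotvC => wB1.
  under eq_bigr do rewrite mulrN.
  by rewrite sumrN lerN2 => /(_ wB1 B BN wB) ->.
split; first exact: (polytope_subset (argmin_sub N _) (ex_intro _ w (And3 w0 w1 erefl))).
move=> _ [u [u0 u1 ->]]; rewrite !dotv_sum.
apply: (@le_trans _ _ (dotv (e B1) c)).
  rewrite -[leRHS]mul1r -u1 mulr_suml; apply: ler_sum => B BN.
  by rewrite ler_wpM2l ?u0// -lerN2 B1m.
rewrite -[leLHS]mul1r -w1 mulr_suml; apply: ler_sum => B BN.
by rewrite -(oppr_inj (argmin_eq BN B1t)).
Qed.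

Lemma proper_faceP N F : N != finset.set0 -> is_proper_face (P N) F -> F !=set0 ->
  exists c, F = P (top N c) /\ top N c != N.
Proof.
move=> N0 [[->|[c FE]] FN] F0; first by case: F0.
rewrite polytope_face// in FE; exists c; split => //.
by apply/eqP => E; apply: FN; rewrite FE E.
Qed.

Lemma proper_face_top N c : N != finset.set0 -> top N c != N ->
  is_proper_face (P N) (P (top N c)).
Proof.
move=> N0 cN; split; first by right; exists c; rewrite polytope_face.
by move=> /polytope_inj E; rewrite E eqxx in cN.
Qed.

End Polytope.

(** * Cells of the regular subdivision and the ground set of the closure *)

Section Cells.
Set Implicit Arguments.
Unset Strict Implicit.
Local Open Scope classical_set_scope.
Variables (R : realType) (n : nat) (M : {set {set 'I_n}}) (v : {set 'I_n} -> R).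
Hypothesis M0 : M != finset.set0.
Implicit Types (x y z c p q : 'rV[R]_n) (A B C : {set 'I_n}).
Implicit Types (s t : set 'rV[R]_n).
Local Notation e := (incidence_vector R).
Local Notation P := (matroid_polytope R).
Local Notation top c := (argmin M (fun C => - dotv (e C) c)).
Local Notation sel := (selected M v).

Let lDZ C x (t : R) y : dotv (e C) (x + t *: y) = dotv (e C) x + t * dotv (e C) y.
Proof. exact: dotvDZ. Qed.

Lemma selected_ex x : exists B, B \in sel x.
Proof. by have /set0Pn[A AM] := M0; apply: argmin_ex AM. Qed.

Lemma selected_neq0 x : sel x != finset.set0.
Proof. by apply/set0Pn; exact: selected_ex. Qed.

Lemma is_cell_selected x : is_cell M v (P (sel x)).
Proof.
exists x; right; exists 0; rewrite polytope_face ?selected_neq0//.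
congr P; apply/setP => B; apply/idP/argminP => [Bx|[]//].
by split => // C _; rewrite !dotv0.
Qed.

Lemma cellP s : is_cell M v s -> s !=set0 -> exists x, s = P (sel x).
Proof.
move=> [x [->[]//|[c ->]]] _; rewrite polytope_face ?selected_neq0//.
have [y yE] := sel_face (l := fun C => dotv (e C)) M v lDZ x c.
by exists y; congr P; exact: (esym yE).
Qed.

(** In direction [e B] the value at [C] is the size of the intersection of [B] and [C]; since all
    bases have equal size, [B] is the only maximiser. Thus each vertex is a cell. *)
Lemma selected_set1 r B : has_rank r M -> B \in M ->
  exists x, sel x = [set B]%SET.
Proof.
move=> rM BM.
have dotE C : dotv (e C) (e B) = #|C :&: B|%:R.
  rewrite /dotv -sum1_card natr_sum [RHS]big_mkcond; apply: eq_bigr => i _.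
  by rewrite !mxE finset.in_setI; case: (i \in C); case: (i \in B); rewrite ?mulr0 ?mulr1.
have topB : top (e B) = [set B]%SET.
  apply/setP => C; rewrite finset.in_set1; apply/argminP/eqP => [[CM]|->].
    move/(_ B BM); rewrite lerN2 !dotE finset.setIid ler_nat => h.
    have BC : (B \subset C)%SET.
      apply/finset.setIidPr/eqP; rewrite eqEcard subsetIr/=; exact: h.
    by apply/esym/eqP; rewrite eqEcard BC (rM B BM) (rM C CM)/=.
  split => // D DM; rewrite lerN2 !dotE finset.setIid ler_nat.
  by apply: subset_leq_card; apply: finset.subsetIr.
have [y yE] := top_sel (l := fun C => dotv (e C)) M v lDZ 0 (e B).
exists y; transitivity (argmin (top (e B)) (fun C => v C - dotv (e C) 0)).
  exact: yE.
rewrite topB.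
have [D] := argmin_ex (fun C => v C - dotv (e C) 0) (set11 B).
move=> DB; apply/eqP; rewrite finset.eqEsubset argmin_sub/= finset.sub1set.
have := fintype.subsetP (argmin_sub _ _) _ DB; rewrite finset.in_set1 => /eqP DE.
by rewrite -{1}DE.
Qed.

Lemma ground_max x : (forall y, sel x \subset sel y -> sel y = sel x) ->
  ground M v (P (sel x)).
Proof.
move=> h; left; split; first exact: is_cell_selected.
move=> t tc xt; have [B Bx] := selected_ex x.
have [|y tE] := cellP tc; first by exists (e B); apply/xt/polytope_vertex.
by rewrite tE h//; apply/(polytope_subE R); rewrite -tE.
Qed.

Lemma facet_top c : top c != M ->
  (forall d, top c \subset top d -> top d != M -> top d = top c) ->
  is_facet (P M) (P (top c)).
Proof.
move=> cM h; split; first exact: proper_face_top.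
move=> G GM cG; have /set0Pn[A AM] := M0.
have [B Bc] := argmin_ex (fun C => - dotv (e C) c) AM.
have [|d [GE dM]] := proper_faceP M0 GM; first by exists (e B); apply/cG/polytope_vertex.
by rewrite GE h//; apply/(polytope_subE R); rewrite -GE.
Qed.

(** The last hypothesis ranges over all directions [d] because [max_facet_cells] compares cells
    lying in possibly different facets. *)
Lemma ground_facet x c : sel x \subset top c -> top c != M ->
  (forall d, top c \subset top d -> top d != M -> top d = top c) ->
  (forall y d, sel x \subset sel y -> sel y \subset top d -> top d != M ->
    sel y = sel x) ->
  ground M v (P (sel x)).
Proof.
move=> xc cM cmax xmax; right; split; first exact: is_cell_selected.
  by exists (P (top c)); [exact: facet_top|apply/(polytope_subE R)].
move=> t tc [F [FM _] tF] xt; have [B Bx] := selected_ex x.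
have tB : t (e B) by apply/xt/polytope_vertex.
have [|y tE] := cellP tc; first by exists (e B).
have [|d [FE dM]] := proper_faceP M0 FM; first by exists (e B); apply: tF.
rewrite tE (xmax y d)//; apply/(polytope_subE R); first by rewrite -tE.
by rewrite -tE -FE.
Qed.

Lemma ground_separates z B : B \in M -> B \notin sel z ->
  exists x, [/\ ground M v (P (sel x)), sel z \subset sel x & B \notin sel x].
Proof.
move=> BM Bz.
have [[x [zx Bx xmax]]|[d [zd Bd]]] :=
  max_sel_or_top (l := fun C => dotv (e C)) lDZ M0 BM Bz.
  by exists x; split => //; exact: ground_max.
have [c [zc Bc cmax]] :=
  top_max (l := fun C => dotv (e C)) lDZ zd (selected_neq0 z) BM Bd.
have cM : top c != M by apply: contraNneq Bc => ->.
have [x [zx xc xmax]] :=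
  sel_top_max (l := fun C => dotv (e C)) lDZ M0 zc cM cmax.
exists x; split => //; first exact: ground_facet xc cM cmax xmax.
by apply: contra Bc; exact: fintype.subsetP.
Qed.

Lemma ground_above z : exists x, ground M v (P (sel x)) /\ sel z \subset sel x.
Proof.
have [Mz|/fintype.subsetPn[B BM Bz]] := boolP (M \subset sel z); last first.
  by have [x []] := ground_separates BM Bz; exists x.
exists z; split => //; apply: ground_max => y zy.
apply/eqP; rewrite finset.eqEsubset zy andbT.
by apply: fintype.subset_trans Mz; apply: argmin_sub.
Qed.

(* Both cells minimise the same lower hull, so their intersection is spanned by
   the common vertices. *)
Lemma weights_cell x y (w : {set 'I_n} -> R) :
  (forall B, B \in sel x -> 0 <= w B) -> \sum_(B in sel x) w B = 1 ->
  P (sel y) (\sum_(B in sel x) w B *: e B) ->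
  forall B, B \in sel x -> w B != 0 -> B \in sel y.
Proof.
move=> w0 w1 [u [u0 u1 wu]] B Bx wB.
have [X Xx] := selected_ex x; have [Y Yy] := selected_ex y.
have [XM Xm] := argminP _ _ _ Xx; have [YM Ym] := argminP _ _ _ Yy.
have selM z C : C \in sel z -> C \in M by apply/fintype.subsetP/argmin_sub.
have mean (N : {set {set 'I_n}}) (a : {set 'I_n} -> R) z : \sum_(C in N) a C * (v C - dotv (e C) z) =
    \sum_(C in N) a C * v C - dotv z (\sum_(C in N) a C *: e C).
  by rewrite dotv_sum -sumrB; apply: eq_bigr => C _; rewrite mulrBr.
have cst (N : {set {set 'I_n}}) (a : {set 'I_n} -> R) z Z : N \subset sel z -> Z \in sel z ->
    \sum_(C in N) a C = 1 ->
    \sum_(C in N) a C * (v C - dotv (e C) z) = v Z - dotv (e Z) z.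
  move=> /fintype.subsetP Nz Zz a1; rewrite -[RHS]mul1r -a1 mulr_suml.
  by apply: eq_bigr => C CN; rewrite (argmin_eq (Nz _ CN) Zz).
have low (N : {set {set 'I_n}}) (a : {set 'I_n} -> R) z Z : N \subset M -> Z \in sel z ->
    (forall C, C \in N -> 0 <= a C) -> \sum_(C in N) a C = 1 ->
    v Z - dotv (e Z) z <= \sum_(C in N) a C * (v C - dotv (e C) z).
  move=> /fintype.subsetP NM /argminP[_ Zm] a0 a1; rewrite -[leLHS]mul1r -a1 mulr_suml.
  by apply: ler_sum => C CN; rewrite ler_wpM2l ?a0// Zm// NM.
have h1 := cst _ w _ _ (fintype.subxx _) Xx w1.
have h2 := cst _ u _ _ (fintype.subxx _) Yy u1.
have h3 := low _ u _ _ (argmin_sub _ _) Xx u0 u1.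
rewrite !mean in h1 h2 h3; rewrite -wu in h2 h3.
have := @weights_argmin _ _ (sel x) w (fun C => v C - dotv (e C) y) (v Y - dotv (e Y) y) w0 w1.
move=> /(_ (fun C Cx => Ym C (selM _ _ Cx))); rewrite mean.
(* [w] and [u] represent the same point and [w] is optimal at [x], so the [w]-mean of [v] is at most
   the [u]-mean; hence [w] is optimal at [y] too. *)
move=> /(_ ltac:(lra) B Bx wB) h.
by apply: (argmin_le Yy (selM _ _ Bx)); rewrite h.
Qed.

(** A point of the intersection has weights on one ground cell. A base of nonzero weight outside
    [sel z] would be missing from some other ground cell containing the point, against
    [weights_cell]. *)
Lemma bigcap_ground z :
  \bigcap_(s in [set g | ground M v g /\ P (sel z) `<=` g]) s = P (sel z).
Proof.
apply/seteqP; split=> [p pF|p pz s [_]]; last exact.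
have [x [gx zx]] := ground_above z.
have [w [w0 w1 pE]] := pF _ (conj gx (proj2 (polytope_subE R _ _) zx)).
rewrite pE in pF *; apply: polytope_restrict => // B Bx wB.
apply/negPn/negP => Bz.
have BM : B \in M by apply: (fintype.subsetP (argmin_sub _ _)) Bx.
have [y [gy zy /negP]] := ground_separates BM Bz; apply.
apply: (weights_cell w0 w1) Bx wB.
exact: pF _ (conj gy (proj2 (polytope_subE R _ _) zy)).
Qed.

(** This makes the closed set attached to a cell a proper subset of [ground]. *)
Lemma ground_not_above r z : has_rank r M ->
  exists g, ground M v g /\ ~ P (sel z) `<=` g.
Proof.
move=> rM; have [B Bz] := selected_ex z.
have BM : B \in M by apply: (fintype.subsetP (argmin_sub _ _)) Bz.
(* With a single base, [P_M] is a point whose only facet is empty, so the empty cell lies in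
   [ground] and serves as [g]. *)
have [MB|/fintype.subsetPn[C CM CB]] := boolP (M \subset [set B]%SET).
  have topM c : top c = M.
    apply/eqP; rewrite finset.eqEsubset argmin_sub/=; apply/fintype.subsetP => C CM.
    apply/argminP; split=> // D DM.
    move: (fintype.subsetP MB _ CM) (fintype.subsetP MB _ DM).
    by rewrite !finset.in_set1 => /eqP -> /eqP ->.
  have no_face F : is_proper_face (P M) F -> F = set0.
    move=> FM; apply/eqP/negPn/negP => /set0P F0.
    by have [c []] := proper_faceP M0 FM F0; rewrite topM eqxx.
  exists set0; split; last first.
    by move=> /(_ (e B)); apply; apply/polytope_vertex.
  have B_M : P M (e B) by apply/polytope_vertex.
  right; split.
  - by exists z; left.
  - exists set0 => //; split; last by move=> G /no_face.
    by split; [left|move=> E; rewrite -E in B_M].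
  - move=> t _ [F [/no_face -> _] ts] _.
    by apply/seteqP; split.
have [x xC] := selected_set1 rM CM.
have [|y [gy _ By]] := @ground_separates x B BM.
  rewrite xC finset.in_set1; apply: contra CB => /eqP ->; exact: set11.
exists (P (sel y)); split => // /polytope_subE /fintype.subsetP /(_ _ Bz).
exact/negP.
Qed.

(** * Dual cells and the union of the extended tight span *)

(** If some [C] strictly beat a base [B] of [s] at [z], it would do so near [z] by continuity, hence
    at a point whose cell is [s]. *)
Lemma dual_cell_selected s z : dual_cell M v s z ->
  exists2 x, s = P (sel x) & sel x \subset sel z.
Proof.
move=> sz; have [x0 [xs _]] := sz _ filterT.
exists x0 => //; apply/fintype.subsetP => B Bx.
have [BM _] := argminP _ _ _ Bx.
apply/argminP; split => // C CM; rewrite leNgt; apply/negP => CB.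
pose f x : R := (v B - dotv (e B) x) - (v C - dotv (e C) x).
have fz : f x @[x --> z] --> f z.
  exact: (cvgB (cvgB (cvg_cst (v B)) (@dotv_continuous R n (e B) z))
    (cvgB (cvg_cst (v C)) (@dotv_continuous R n (e C) z))).
have [|x [xs' fx]] := sz (fun x => 0 < f x).
  by apply: (cvgr_gt _ fz); rewrite subr_gt0.
have : B \in sel x by rewrite -(polytope_inj (etrans xs' (esym xs))) in Bx.
by move=> /argminP[_ /(_ C CM)]; rewrite leNgt -subr_gt0 fx.
Qed.

Lemma loop_free_subset (N N' : {set {set 'I_n}}) : N \subset N' -> loop_free N -> loop_free N'.
Proof.
move=> NN' Nl; apply/setP => i; rewrite finset.in_setT; apply/bigcupP.
have /bigcupP[B BN iB] : i \in (\bigcup_(B in N) B)%SET by rewrite Nl finset.in_setT.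
by exists B => //; apply: (fintype.subsetP NN').
Qed.

(** Stated for any [Gamma] made of loopy cells and containing every loopy [P (sel x)], so that it
    covers both notions of boundary. *)
Lemma tight_span_loop_free r (Gamma : set (set 'rV[R]_n)) : has_rank r M ->
  (forall t, Gamma t -> [/\ is_cell M v t, t !=set0 & ~ loop_free (cell_bases t)]) ->
  (forall x, ~ loop_free (sel x) -> Gamma (P (sel x))) ->
  [set x | loop_free (sel x)] = union_of_cells (extended_tight_span M v Gamma).
Proof.
move=> rM Gl lG; apply/seteqP; split => [z zl|z [_ [F [[Fg nF] FG] <-]]].
  pose F := [set g | ground M v g /\ P (sel z) `<=` g].
  have FE : \bigcap_(s in F) s = P (sel z) := bigcap_ground z.
  have [x [gx /(polytope_subE R) zx]] := ground_above z.
  have Fne : F !=set0 by exists (P (sel x)).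
  have clF : cl M v F = F.
    by apply/seteqP; split => [g [_ gg]|g [gg zg]]; rewrite /cl /= FE.
  exists (rho M v F); last first.
    rewrite /rho; case: asboolP => [F0|_].
      by case: Fne => g; rewrite F0.
    by rewrite FE; apply: subset_closure.
  exists F => //; split.
    split; first by move=> g [].
    have [g [gg zg]] := ground_not_above z rM.
    by move=> /(_ g gg)[].
  rewrite /cl_Gamma clF; case: asboolP => // nL; exfalso; apply: nL.
  split => //; first by move=> g [].
  move=> t Gt; rewrite FE => zt; have [tc t0 tl] := Gl _ Gt; apply: tl.
  have [y tE] := cellP tc t0; rewrite tE cell_bases_polytope.
  by apply: loop_free_subset zl; apply/(polytope_subE R); rewrite -tE.
rewrite /rho; case: asboolP => // _ rz.
(* Since [F] is a proper subset of [ground], it is not the default value of [cl_Gamma]. *)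
have {FG} [_ _ FG] : Lambda M v Gamma F.
  move: FG; rewrite /cl_Gamma; case: asboolP => [h hF|_ gF]; first by rewrite hF in h.
  by exfalso; apply: nF; rewrite gF.
have [x xE xz] := dual_cell_selected rz.
apply: loop_free_subset xz _; apply: contrapT => /lG /FG; apply.
by rewrite xE.
Qed.

(** * Loopy cells lie in the boundary *)

Lemma polytope_topological_boundary r : has_rank r M -> (0 < n)%N ->
  P M `<=` topological_boundary (P M).
Proof.
move=> rM n0 p pM; split; first exact: subset_closure.
move=> /nbhs_ballP[d /= d0 dP].
have sumE q : P M q -> dotv (const_mx 1) q = r%:R.
  move=> [w [_ w1 ->]]; rewrite dotv_sum -[RHS]mul1r -[X in _ = X * _]w1 mulr_suml.
  apply: eq_bigr => B BM; congr (_ * _); rewrite -(rM B BM) -sum1_card natr_sum.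
  rewrite [RHS]big_mkcond; apply: eq_bigr => i _.
  by rewrite !mxE mulr1; case: (i \in B).
(* This point of the ball leaves the hyperplane: its coordinate sum is off by [n * d / 2]. *)
have /dP/sumE : ball p d (p + (d / 2) *: const_mx 1).
  split => // i j; rewrite /ball/= !mxE mulr1 opprD addNKr normrN gtr0_norm; lra.
rewrite dotvDZ sumE// => /eqP; rewrite -subr_eq0 addrAC subrr add0r; apply/negP.
rewrite mulf_neq0 ?gt_eqF ?divr_gt0//.
suff -> : dotv (const_mx 1) (const_mx 1 : 'rV[R]_n) = n%:R.
  by rewrite ltr0n.
rewrite /dotv (eq_bigr (fun=> 1)); last by move=> i _; rewrite !mxE mulr1.
by rewrite sumr_const card_ord.
Qed.

(** A loop [i] of the cell puts it in the face where coordinate [i] vanishes, which is proper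
    because [i] is not a loop of [M]. *)
Lemma loopy_cell_relative_boundary x : loop_free M -> ~ loop_free (sel x) ->
  P (sel x) `<=` relative_boundary (P M).
Proof.
move=> Ml xl.
have [i xi] : exists i, forall B, B \in sel x -> i \notin B.
  apply: contrapT => /forallNP h; apply: xl; apply/setP => i.
  rewrite finset.in_setT; apply/bigcupP; have /existsNP[B /not_implyP[Bx iB]] := h i.
  by exists B => //; apply/negPn/negP.
pose c : 'rV[R]_n := - delta_mx 0 i.
have cE B : - dotv (e B) c = (i \in B)%:R.
  rewrite /dotv (bigD1 i)//= big1 => [|j ji].
    by rewrite !mxE !eqxx addr0 mulrN mulr1 opprK.
  by rewrite !mxE (negbTE ji) oppr0 mulr0.
have [X Xx] := selected_ex x.
have selM B : B \in sel x -> B \in M by apply/fintype.subsetP/argmin_sub.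
have xc : sel x \subset top c.
  apply/fintype.subsetP => B Bx; apply/argminP; split; first exact: selM.
  by move=> C _; rewrite !cE (negbTE (xi _ Bx)).
have cM : top c != M.
  apply/eqP => cM.
  have /bigcupP[B BM iB] : i \in (\bigcup_(B in M) B)%SET by rewrite Ml finset.in_setT.
  move: BM; rewrite -cM => /argminP[_ /(_ X (selM _ Xx))].
  by rewrite !cE iB (negbTE (xi _ Xx)) ler10.
move=> p /(polytope_subset xc) pc; exists (P (top c)) => //.
exact: proper_face_top.
Qed.

End Cells.

Theorem theorem4p4 (R : realType) (n r : nat) (M : {set {set 'I_n}})
    (v : {set 'I_n} -> R) :
  (1 <= n)%N -> (1 <= r <= n)%N ->
  is_matroid M -> has_rank r M ->
  is_valuated_matroid M v ->
  (tropical_linear_space M v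
     = mod_ones (union_of_cells (extended_tight_span M v (boundary_loopy_cells M v))))
  /\
  (loop_free M ->
   tropical_linear_space M v
     = mod_ones (union_of_cells
         (extended_tight_span M v (relative_boundary_loopy_cells M v)))).
Proof.
move=> n0 _ [[A AM] _] rM _.
have M0 : M != finset.set0 by apply/set0Pn; exists A.
have sel_loopy bd x : (matroid_polytope R (selected M v x) `<=` bd)%classic ->
    ~ loop_free (selected M v x) ->
    loopy_cells_in bd M v (matroid_polytope R (selected M v x)).
  move=> xbd xl; split => //; first exact: is_cell_selected.
    by have [B Bx] := selected_ex v M0 x; exists (incidence_vector R B); apply/polytope_vertex.
  by rewrite cell_bases_polytope.
(* The two halves differ only in why a loopy cell lies in the boundary. *)
split=> [|Ml]; rewrite /tropical_linear_space; congr mod_ones;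
  apply: (tight_span_loop_free M0 rM) => [t []//|x xl]; apply: sel_loopy => //.
  move=> p xp; apply: (polytope_topological_boundary rM n0).
  exact: (polytope_subset (argmin_sub _ _)) xp.
exact: loopy_cell_relative_boundary.
Qed.
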